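(* Let $\mathcal{J}\colon 2^{\mathbb{N}}\to 2^{\mathbb{N}}$ be an operator with $\mathcal{J}(\emptyset)=\emptyset$, and let $\mathcal{A}\subseteq 2^{\mathbb{N}}$ be the associated family $\mathcal{A}=\{A\subseteq\mathbb{N}\colon A\cap\mathcal{J}^{+}(A)=\emptyset\}$, assumed to be closed under taking subsets. Let $\mathcal{F}\colon\{0,1\}^{\mathbb{N}}\to\mathcal{A}$ and $\mathcal{G}\colon 2^{\mathbb{N}}\to\{0,1\}^{\mathbb{N}}$ be the mappings associated with $\mathcal{J}$ defined in the context, and give $\mathcal{A}$ the relative topology from $2^{\mathbb{N}}$. Then the following statements hold. \begin{itemize} \item The mapping $\mathcal{F}\colon\{0,1\}^{\mathbb{N}}\to\mathcal{A}$ is a continuous bijection. \item The mapping $\mathcal{G}\colon 2^{\mathbb{N}}\to\{0,1\}^{\mathbb{N}}$ is a continuous surjection. \item The restriction of $\mathcal{G}$ to the domain $\mathcal{A}$ is a continuous bijection $\mathcal{A}\to\{0,1\}^{\mathbb{N}}$. Consequently, $\mathcal{F}$ is a homeomorphism. \end{itemize}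
   Context: $\mathbb{N}=\{1,2,\ldots\}$; $2^{\mathbb{N}}$ is the power set of $\mathbb{N}$, identified with $\{0,1\}^{\mathbb{N}}$ via characteristic functions. The topology on $2^{\mathbb{N}}$ (and on $\{0,1\}^{\mathbb{N}}$ via this identification) is that of the metric $\rho(A,B)=0$ if $A=B$ and $\rho(A,B)=2^{-N_0+1}$ if $A\neq B$, where $N_0=\min\{a\in\mathbb{N}\colon A\cap\{1,\ldots,a\}\neq B\cap\{1,\ldots,a\}\}$. Closed under taking subsets means: if $A\in\mathcal{A}$ and $B\subseteq A$, then $B\in\mathcal{A}$. Write $A\subseteq\mathbb{N}$ as an increasing sequence $A=\{a_1<a_2<\cdots\}$ (finite or infinite). For $i\ge 1$ put $$\mathcal{J}_i(A)=\{a\in\mathbb{N}\colon a_i<a<a_{i+1}\text{ and }a\in\mathcal{J}(\{a_1,\ldots,a_i\})\},$$ where, if $A$ is finite and $i\ge |A|$, the condition $a_i<a<a_{i+1}$ is replaced by $a_{|A|}<a<\infty$ and $\{a_1,\ldots,a_i\}$ means $A$. Also $$\mathcal{J}_i^{+}(A)=\{a\in\mathbb{N}\colon a_i<a<\infty\text{ and }a\in\mathcal{J}(\{a_1,\ldots,a_i\})\},\qquad \mathcal{J}^{+}(A)=\bigcup_{i=1}^{\infty}\mathcal{J}_i^{+}(A)$$ (with the same convention when $A$ is finite and $i\ge|A|$). For $A=\emptyset$ all these sets are empty. Definition of $\mathcal{F}$: given $\sigma=(\sigma_n)_{n\in\mathbb{N}}\in\{0,1\}^{\mathbb{N}}$,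 put $A_0=B_0=\emptyset$. For $n=1,2,\ldots$ let $a_n$ be the smallest positive integer not in $A_{n-1}\cup\mathcal{J}(A_{n-1})\cup B_{n-1}$. If $\sigma_n=1$, set $A_n=A_{n-1}\cup\{a_n\}$ and $B_n=B_{n-1}$; if $\sigma_n=0$, set $A_n=A_{n-1}$ and $B_n=B_{n-1}\cup\{a_n\}$. Then $\mathcal{F}(\sigma)=\bigcup_{n=1}^{\infty}A_n$. Definition of $\mathcal{G}$: given $A\in 2^{\mathbb{N}}$, form the ternary sequence $\sigma'=(\sigma'_a)_{a\in\mathbb{N}}\in\{0,1,*\}^{\mathbb{N}}$ with $\sigma'_a=1$ if $a\in A$, $\sigma'_a=*$ if $a\in\mathcal{J}_i(A)$ for some $i$, and $\sigma'_a=0$ otherwise. Then $\mathcal{G}(A)\in\{0,1\}^{\mathbb{N}}$ is the sequence obtained from $\sigma'$ by deleting all the $*$'s. Standing assumption: these procedures do define mappings $\mathcal{F}\colon\{0,1\}^{\mathbb{N}}\to\mathcal{A}$ and $\mathcal{G}\colon2^{\mathbb{N}}\to\{0,1\}^{\mathbb{N}}$; that is, each $a_n$ exists, $\mathcal{F}(\sigma)\in\mathcal{A}$ for every $\sigma$, and the sequence left after deleting the $*$'s is always infinite. *)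

(* Defs.v *)
From HB Require Import structures.
From mathcomp Require Import all_boot all_order all_algebra.
From mathcomp Require Import all_classical all_reals topology.

Set Implicit Arguments.
Unset Strict Implicit.
Unset Printing Implicit Defensive.

Import Order.TTheory GRing.Theory Num.Theory.
Local Open Scope classical_set_scope.
Local Open Scope ring_scope.

Definition Npos := {n : nat | (0 < n)%N}.
Definition Npos_nat (a : Npos) : nat := val a.
Coercion Npos_nat : Npos >-> nat.

Definition succN (n : nat) : Npos := exist _ n.+1 isT.

Definition is_least (S : set Npos) (a : Npos) : Prop :=
  S a /\ forall b, S b -> (a <= b)%N.

(* Meaningful only for nonempty S; the value for S = set0 is irrelevant. *)
Definition least (S : set Npos) : Npos := xget (succN 0) [set a | is_least S a].

(* is_nth S i x: x is the i-th term (i >= 1) of the increasing enumeration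
   of S.  There is no such x when i > |S|. *)
Inductive is_nth (S : set Npos) : nat -> Npos -> Prop :=
| is_nth_first x : is_least S x -> is_nth S 1 x
| is_nth_next i x y : is_nth S i x ->
    is_least (S `&` [set z : Npos | (x < z)%N]) y -> is_nth S i.+1 y.

(* {a_1, ..., a_i}; this is A itself when A is finite and i >= |A|. *)
Definition firsts (A : set Npos) (i : nat) : set Npos :=
  [set x | exists2 j, (j <= i)%N & is_nth A j x].

Section Operator.
Variable J : set Npos -> set Npos.

(* For nonempty A, being above all of {a_1, ..., a_i} means a_i < a if
   i < |A| and a_|A| < a if i >= |A|. *)
Definition Jplus_i (A : set Npos) (i : nat) : set Npos :=
  [set a : Npos | [/\ A !=set0, (forall x, firsts A i x -> (x < a)%N) &
               J (firsts A i) a]].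

(* The bound a < a_{i+1} is vacuous when A has no (i+1)-st element. *)
Definition J_i (A : set Npos) (i : nat) : set Npos :=
  Jplus_i A i `&` [set a : Npos | forall x, is_nth A i.+1 x -> (a < x)%N].

Definition Jplus (A : set Npos) : set Npos :=
  \bigcup_(i in [set i | (0 < i)%N]) Jplus_i A i.

Definition calA : set (set Npos) := [set A | A `&` Jplus A = set0].

Definition candidates (AB : set Npos * set Npos) : set Npos :=
  ~` (AB.1 `|` J AB.1 `|` AB.2).

(* The pair (A_n, B_n); a_n is the least candidate for (A_{n-1}, B_{n-1}). *)
Fixpoint greedy (s : Npos -> bool) (n : nat) : set Npos * set Npos :=
  if n is m.+1 then
    let AB := greedy s m in
    let a := least (candidates AB) in
    if s (succN m) then (a |` AB.1, AB.2) else (AB.1, a |` AB.2)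
  else (set0, set0).

Definition calF (s : Npos -> bool) : set Npos :=
  \bigcup_(n in [set n | (0 < n)%N]) (greedy s n).1.

(* The symbol * is encoded as None. *)
Definition ternary (A : set Npos) (a : Npos) : option bool :=
  if `[< A a >] then Some true
  else if `[< exists2 i, (0 < i)%N & J_i A i a >] then None
  else Some false.

End Operator.

Definition kept (t : Npos -> option bool) : set Npos := [set a | t a <> None].

(* The n-th term of the result is the value of t at its n-th kept position;
   the defaults are irrelevant when infinitely many positions are kept. *)
Definition delete_stars (t : Npos -> option bool) (n : Npos) : bool :=
  odflt false (t (xget (succN 0) [set a : Npos | is_nth (kept t) n a])).

Definition calG (J : set Npos -> set Npos) (A : set Npos) : Npos -> bool :=
  delete_stars (ternary J A).

Definition upto (a : nat) : set Npos := [set b : Npos | (b <= a)%N].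

Definition rho (R : realType) (A B : set Npos) : R :=
  if `[< A = B >] then 0
  else 2 ^ (- (least [set a : Npos | A `&` upto a <> B `&` upto a] : nat)%:Z + 1).

Lemma leastP (S : set Npos) : S !=set0 -> is_least S (least S).
Proof.
move=> S0; rewrite /least; case: xgetP => //= h.
have ex : exists n, `[< exists2 a, S a & Npos_nat a = n >].
  by case: S0 => a Sa; exists a; apply/asboolP; exists a.
case: (ex_minnP ex) => n /asboolP[a Sa an] nmin.
exfalso; apply: (h a); split=> // b Sb.
by rewrite an; apply: nmin; apply/asboolP; exists b.
Qed.

Section Rho.
Variable R : realType.
Implicit Types A B C : set Npos.

Lemma rhoxx A : rho R A A = 0.
Proof. by rewrite /rho; case: asboolP. Qed.

Lemma rho_positivity A B : rho R A B = 0 -> A = B.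
Proof.
rewrite /rho; case: asboolP => // _ /eqP.
by rewrite expfz_eq0 pnatr_eq0 andbF.
Qed.

Lemma rho_sym A B : rho R A B = rho R B A.
Proof.
rewrite /rho (asbool_equiv_eq (Q := B = A)); last by split=> ->.
congr (if _ then _ else 2 ^ (- (least _ : nat)%:Z + 1)).
by apply/seteqP; split=> a /= h e; apply: h.
Qed.

Lemma rho_ge0 A B : 0 <= rho R A B.
Proof. by rewrite /rho; case: ifP => // _; rewrite exprz_ge0. Qed.

Lemma differ A B : A <> B -> [set a : Npos | A `&` upto a <> B `&` upto a] !=set0.
Proof.
move=> AB; apply: contrapT => h; apply: AB; apply/seteqP.
have e (a : Npos) : A `&` upto a = B `&` upto a.
  by apply: contrapT => ne; apply: h; exists a.
split=> a Xa.
- have : (A `&` upto a) a by split=> //=; rewrite /upto /=.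
  by rewrite e => -[].
- have : (B `&` upto a) a by split=> //=; rewrite /upto /=.
  by rewrite -e => -[].
Qed.

Lemma rho_ultra B A C : rho R A C <= Num.max (rho R A B) (rho R B C).
Proof.
have [->|AC] := pselect (A = C); first by rewrite rhoxx le_max rho_ge0.
have [->|AB] := pselect (A = B); first by rewrite le_max lexx orbT.
have [->|BC] := pselect (B = C); first by rewrite le_max lexx.
rewrite /rho; do 3 case: asboolP => // _.
have [nAC _] := leastP (differ AC).
have [_ mAB] := leastP (differ AB).
have [_ mBC] := leastP (differ BC).
set n := least _ in nAC *.
have : (A `&` upto n <> B `&` upto n) \/ (B `&` upto n <> C `&` upto n).
  have [e|] := pselect (A `&` upto n = B `&` upto n); last by left.
  by right; rewrite -e.
have mono (p q : Npos) : (p <= q)%N ->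
    (2 : R) ^ (- (q : nat)%:Z + 1) <= 2 ^ (- (p : nat)%:Z + 1).
  by move=> pq; rewrite ler_weXz2l ?ler1n// lerD2r lerN2 lez_nat.
by rewrite le_max; case=> [/mAB|/mBC] /mono ->; rewrite ?orbT.
Qed.

Lemma rho_triangle B A C : rho R A C <= rho R A B + rho R B C.
Proof.
apply: le_trans (rho_ultra B A C) _.
by rewrite ge_max lerDl lerDr !rho_ge0.
Qed.

End Rho.

(* The parameter R is only there to let the metric structures below be inferred:
   it is the field in which distances take their values. *)
Definition powN (R : realType) : Type := set Npos.
Definition binseq (R : realType) : Type := Npos -> bool.

Section Metric.
Variable R : realType.

HB.instance Definition _ := gen_eqMixin (powN R).
HB.instance Definition _ := gen_choiceMixin (powN R).
HB.instance Definition _ := @isMetric.Build R (powN R) (rho R)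
  (@rhoxx R) (@rho_positivity R) (@rho_sym R) (@rho_triangle R).

Definition supp (s : Npos -> bool) : set Npos := [set a | s a].

Lemma supp_inj : injective supp.
Proof.
move=> s t e; apply/funext => a.
by apply/idP/idP => h; [have : supp s a by []|have : supp t a by []];
  rewrite ?e // -e.
Qed.

Definition brho (s t : Npos -> bool) : R := rho R (supp s) (supp t).

HB.instance Definition _ := gen_eqMixin (binseq R).
HB.instance Definition _ := gen_choiceMixin (binseq R).
HB.instance Definition _ := @isMetric.Build R (binseq R) brho
  (fun s => rhoxx R _)
  (fun s t e => supp_inj (rho_positivity e))
  (fun s t => rho_sym R _ _)
  (fun t s u => rho_triangle R _ _ _).

End Metric.

Definition homeomorphism (S T : topologicalType) (f : S -> T) : Prop :=
  continuous f /\
  exists g : T -> S, [/\ cancel f g, cancel g f & continuous g].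

(* calA with the topology induced by the inclusion into powN R. *)
Definition subA (R : realType) (J : set Npos -> set Npos) : Type :=
  @set_type (powN R) (calA J).
HB.instance Definition _ R J := Topological.on (@subA R J).

(* Main.v *)
Require Import Defs.
From HB Require Import structures.
From mathcomp Require Import all_boot all_order all_algebra.
From mathcomp Require Import all_classical all_reals topology.
From mathcomp Require Import zify.
Local Open Scope classical_set_scope.

Set Implicit Arguments.
Unset Strict Implicit.
Unset Printing Implicit Defensive.

Import Order.TTheory GRing.Theory Num.Theory.

(** The idea is that [F] and [G] are the two directions of one left-to-right
    reading of a set.

    Whether a position [x] outside [A] is starred depends only on the elements
    of [A] preceding [x]: it means [J (below A x) x] ([starredP]).  Hence the
    ternary sequence of [A] up to [x] is determined by [A] up to [x].  The
    [n]-th term of [G A] is read at the [n]-th kept position [p], so it is the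
    same for all sets agreeing with [A] up to [p]; this is the continuity of [G]
    ([calG_local]).

    A member of the family never contains a position starred by its own
    preceding elements.  At the first position where two members differ, the
    preceding elements are the same for both, so neither stars that position;
    both keep it, with the same number and opposite values.  Hence [G] is
    injective on the family ([calG_inj]).

    For [F], the point is that the integers a_1, a_2, ... examined by the
    greedy procedure increase ([frontierP]).  An integer skipped once could
    only come back by leaving [J (A_n)] after [A_n] has grown; accepting it
    would then produce a subset of some [F t] that violates the defining
    condition of the family, whereas the family contains every [F t] and is
    closed under subsets.  So the integers skipped are exactly the starred
    positions of [F s], the a_n are exactly the kept ones, and the value kept at
    a_n is [s n]: that is, [G (F s) = s] ([calFK]).  Since a_n is at least [n],
    the first [n] terms of [s] determine [F s] up to [n], which is the
    continuity of [F] ([calF_agree]).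

    Surjectivity of [G] and injectivity of [F] follow from [G (F s) = s];
    together with the injectivity of [G] on the family this makes [F] and the
    restriction of [G] mutually inverse.  Topologically, only agreement on
    initial segments matters: the points agreeing with a given one on an initial
    segment form its basic neighbourhoods ([nbhs_powN], [nbhs_binseq]). *)

(** * Initial segments and ranks of sets of positive integers *)

Definition agree {T : Type} (k : nat) (f g : Npos -> T) : Prop :=
  forall x : Npos, (x < k)%N -> f x = g x.

Definition below (A : set Npos) (k : nat) : set Npos :=
  A `&` [set y : Npos | (y < k)%N].

(** The index [k] stands for the integer [k.+1], so this counts the elements
    of [S] that are at most [m]. *)
Definition count_upto (S : set Npos) (m : nat) : nat :=
  \sum_(k < m) `[< S (succN k) >].

Definition rank (S : set Npos) (x : Npos) : nat := count_upto S x.-1.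

Lemma Npos_inj (x y : Npos) : (x = y :> nat) -> x = y.
Proof. exact: val_inj. Qed.

Lemma Npos_gt0 (x : Npos) : (0 < x)%N.
Proof. by case: x. Qed.

Lemma succN_pred (x : Npos) : succN x.-1 = x.
Proof. by apply: Npos_inj; exact: prednK (Npos_gt0 x). Qed.

Lemma succN_ltn (k : nat) (x : Npos) : (succN k < x)%N = (k < x.-1)%N.
Proof. by rewrite -ltn_predRL. Qed.

Lemma Npos_ltn_ind (P : Npos -> Prop) :
  (forall x : Npos, (forall y : Npos, (y < x)%N -> P y) -> P x) ->
  forall x, P x.
Proof.
move=> ih x; have [n] := ubnP (x : nat); elim: n x => // n IHn x xn.
by apply: ih => y yx; apply: IHn; lia.
Qed.

Lemma agreeW {T : Type} {k l : nat} {f g : Npos -> T} :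
  (k <= l)%N -> agree l f g -> agree k f g.
Proof. by move=> kl h x xk; apply: h; exact: leq_trans xk kl. Qed.

Lemma agree_sym {T : Type} {k : nat} {f g : Npos -> T} :
  agree k f g -> agree k g f.
Proof. by move=> h x /h. Qed.

Lemma agree_below (k : nat) (A B : set Npos) :
  agree k A B -> below A k = below B k.
Proof.
move=> h; apply/seteqP.
by split=> x [Xx xk]; split=> //; [rewrite -h|rewrite h].
Qed.

Lemma count_upto_le (S : set Npos) (m n : nat) :
  (m <= n)%N -> (count_upto S m <= count_upto S n)%N.
Proof.
elim: n => [|n IHn]; first by rewrite leqn0 => /eqP ->.
rewrite leq_eqVlt => /predU1P[->//|/IHn h].
by rewrite {2}/count_upto big_ord_recr /=; apply: leq_trans h (leq_addr _ _).
Qed.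

Lemma rank_le (S : set Npos) (x y : Npos) :
  (x <= y)%N -> (rank S x <= rank S y)%N.
Proof. by move=> xy; apply: count_upto_le; lia. Qed.

Lemma count_upto_val (S : set Npos) (x : Npos) :
  count_upto S x = (rank S x + `[< S x >])%N.
Proof.
by rewrite -{1}(prednK (Npos_gt0 x)) /count_upto big_ord_recr /= succN_pred.
Qed.

Lemma rank_ltn (S : set Npos) (x y : Npos) :
  S x -> (x < y)%N -> (rank S x < rank S y)%N.
Proof.
move=> Sx xy; have : (count_upto S x <= rank S y)%N.
  by apply: count_upto_le; lia.
by rewrite count_upto_val (asboolT Sx) addn1.
Qed.

Lemma rank_agree (S T : set Npos) (x : Npos) :
  agree x S T -> rank S x = rank T x.
Proof.
move=> h; apply: eq_bigr => k _; congr (nat_of_bool (asbool _)); apply: h.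
by rewrite succN_ltn.
Qed.

Lemma rank_least (S : set Npos) (x : Npos) : is_least S x -> rank S x = 0.
Proof.
move=> [_ h]; rewrite /rank /count_upto big1 // => k _.
by case: asboolP => // /h; rewrite leqNgt succN_ltn ltn_ord.
Qed.

Lemma rank_next (S : set Npos) (x y : Npos) : S x ->
  is_least (S `&` [set z : Npos | (x < z)%N]) y -> rank S y = (rank S x).+1.
Proof.
move=> Sx [[_ /= xy] h].
have <- : count_upto S x = (rank S x).+1.
  by rewrite count_upto_val (asboolT Sx) addn1.
rewrite /rank; have : (x <= y.-1)%N by lia.
have : (y.-1 < y)%N by lia.
elim: y.-1 => [|m IHm] my; first by rewrite leqn0 => /eqP ->.
rewrite leq_eqVlt => /predU1P[->//|xm].
rewrite {1}/count_upto big_ord_recr /= -/(count_upto _ _) IHm; [|lia|lia].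
case: asboolP => //= Sm; last by rewrite addn0.
by have := h (succN m) (conj Sm xm); rewrite leqNgt succN_ltn; lia.
Qed.

(** Being the [i]-th term of the enumeration is a statement about a rank;
    all later arguments use ranks, which visibly depend only on an initial
    segment of the set. *)
Lemma is_nthP (S : set Npos) (i : nat) (x : Npos) :
  is_nth S i x <-> S x /\ i = (rank S x).+1.
Proof.
have sound j y : is_nth S j y -> S y /\ j = (rank S y).+1.
  elim=> {j y} [y yl|j y z _ [Sy ->] zl].
    by split; [case: yl|rewrite rank_least].
  by split; [case: zl => -[]|rewrite (rank_next Sy zl)].
split=> [/sound //|[Sx ->]].
suff [j jx] : exists j, is_nth S j x by have [_ <-] := sound _ _ jx.
elim/Npos_ltn_ind: x Sx => x IHx Sx.
have [xl|] := pselect (is_least S x); first by exists 1; left.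
move=> /not_andP[//|/existsNP[y /not_implyP[Sy /negP]]]; rewrite -ltnNge => yx.
pose P n := `[< exists2 z : Npos, S z & (z < x)%N /\ z = n :> nat >].
have exP : exists n, P n by exists y; apply/asboolP; exists y.
(* the predecessor of [x] in [S] is the largest [n] satisfying [P] *)
have bP n : P n -> (n <= x)%N by move=> /asboolP[z _ [zx <-]]; exact: ltnW.
case: (ex_maxnP exP bP) => n /asboolP[z Sz [zx <-]] zmax.
have [j zj] := IHx z zx Sz; exists j.+1; apply: is_nth_next zj _.
split=> // t [St /= zt]; rewrite leqNgt; apply/negP => tx.
by have := zmax t; rewrite leqNgt zt => /(_ _)/notF; apply; apply/asboolP; exists t.
Qed.

Lemma is_nth_unique (S : set Npos) (i : nat) (x y : Npos) :
  is_nth S i x -> is_nth S i y -> x = y.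
Proof.
move=> /is_nthP[Sx ->] /is_nthP[Sy [e]]; apply: Npos_inj.
have [xy|yx|//] := ltngtP x y.
- by have := rank_ltn Sx xy; rewrite e ltnn.
- by have := rank_ltn Sy yx; rewrite e ltnn.
Qed.

Lemma is_nth_agree (S T : set Npos) (i : nat) (x : Npos) :
  agree x.+1 S T -> is_nth S i x -> is_nth T i x.
Proof.
move=> h /is_nthP[Sx ->]; apply/is_nthP; split; first by rewrite -h.
by rewrite (@rank_agree S T x)//; exact: agreeW h.
Qed.

Lemma is_nth_prefix (S : set Npos) (i j : nat) (y : Npos) :
  (0 < i <= j)%N -> is_nth S j y -> exists2 z : Npos, (z <= y)%N & is_nth S i z.
Proof.
move=> + yj; elim: yj => {j y} [y yl|j y z yj IH [[Sz /= yz] zl]] ij.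
  by exists y => //; have -> : i = 1 by [lia]; left.
have [e|ne] := eqVneq i j.+1.
  by exists z => //; rewrite e; apply: is_nth_next yj _.
have [|t ty ti] := IH; first lia.
by exists t => //; exact: leq_trans ty (ltnW yz).
Qed.

Lemma infinite_above (S : set Npos) (m : nat) :
  infinite_set S -> S `&` [set z : Npos | (m < z)%N] !=set0.
Proof.
move=> Sinf; apply: contrapT => h; apply: Sinf.
apply: (@sub_finite_set _ _ (succN @` `I_m)); last first.
  by apply: finite_image; exact: finite_II.
move=> x Sx; exists x.-1; last exact: succN_pred.
have : ~ (m < x)%N by move=> mx; apply: h; exists x.
by have := Npos_gt0 x; rewrite /=; lia.
Qed.

Lemma infinite_nth (S : set Npos) (n : Npos) :
  infinite_set S -> exists x, is_nth S n x.
Proof.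
move=> Sinf; rewrite -(succN_pred n) /=; elim: n.-1 => [|k [x xk]].
  have [z [Sz _]] := infinite_above 0 Sinf.
  by exists (least S); left; apply: leastP; exists z.
have h := infinite_above x Sinf.
by eexists; apply: is_nth_next xk _; exact: leastP h.
Qed.

(** * Starred positions depend on an initial segment *)

Lemma firsts_rank (A : set Npos) (x : Npos) : firsts A (rank A x) = below A x.
Proof.
apply/seteqP; split=> y /=.
  move=> [j jr /is_nthP[Ay ej]]; split=> //=; rewrite ltnNge; apply/negP => xy.
  by have := rank_le A xy; lia.
move=> [Ay /= yx]; exists (rank A y).+1; last exact/is_nthP.
exact: rank_ltn.
Qed.

Lemma Jplus_below (J : set Npos -> set Npos) (A : set Npos) (x : Npos) :
  J set0 = set0 -> J (below A x) x ->
  (0 < rank A x)%N /\ Jplus_i J A (rank A x) x.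
Proof.
move=> J0 Jx; rewrite /Jplus_i firsts_rank.
have [z [Az zx]] : below A x !=set0.
  apply/set0P/negP => /eqP e; by rewrite e J0 in Jx.
split; first by have := rank_ltn Az zx; lia.
by split=> //; [exists z|move=> t []].
Qed.

(** The index of a block [J_i J A i] is redundant: the block containing a
    position is determined by the elements of [A] to its left.  An empty
    initial segment, for which there is no index, stars nothing because
    [J set0 = set0]. *)
Lemma starredP (J : set Npos -> set Npos) (A : set Npos) (x : Npos) :
  J set0 = set0 -> ~ A x ->
  (exists2 i, (0 < i)%N & J_i J A i x) <-> J (below A x) x.
Proof.
move=> J0 nAx; split=> [[i i0 [[_ lo Jx] hi]]|Jx].
  suff -> : below A x = firsts A i by [].
  apply/seteqP; split=> y; last first.
    by move=> yA; split; [case: yA => j _ /is_nthP[]|exact: lo].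
  move=> [Ay /= yx]; exists (rank A y).+1; last exact/is_nthP.
  rewrite leqNgt; apply/negP => h.
  (* otherwise the [i+1]-st element of [A] lies at or before [y], hence
     before [x] *)
  have yn : is_nth A (rank A y).+1 y by apply/is_nthP.
  have [|z zy zi] := is_nth_prefix (i := i.+1) _ yn; first lia.
  by have := hi z zi; rewrite /=; lia.
have [r0 Jp] := Jplus_below J0 Jx; exists (rank A x) => //; split=> // z.
move=> /is_nthP[Az [e]]; rewrite /= ltnNge; apply/negP => zx.
have [xz|ne] := eqVneq (z : nat) x; first by rewrite (Npos_inj xz) in Az.
have : (z < x)%N by rewrite ltn_neqAle ne.
by move=> /(rank_ltn Az); lia.
Qed.

Lemma ternaryE (J : set Npos -> set Npos) (A : set Npos) (x : Npos) :
  J set0 = set0 ->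
  ternary J A x = if `[< A x >] then Some true
                  else if `[< J (below A x) x >] then None else Some false.
Proof.
move=> J0; rewrite /ternary; case: asboolP => // nAx.
by rewrite (asbool_equiv_eq (starredP J0 nAx)).
Qed.

Lemma ternary_agree (J : set Npos -> set Npos) (A B : set Npos) (k : nat) :
  J set0 = set0 -> agree k A B -> agree k (ternary J A) (ternary J B).
Proof.
move=> J0 h x xk; rewrite !ternaryE // (h x xk).
by rewrite (@agree_below x A B)//; exact: agreeW (ltnW xk) h.
Qed.

Lemma kept_agree (t u : Npos -> option bool) (k : nat) :
  agree k t u -> agree k (kept t) (kept u).
Proof. by move=> h x xk; rewrite /kept /= (h x xk). Qed.

Lemma delete_starsE (t : Npos -> option bool) (n a : Npos) :
  is_nth (kept t) n a -> delete_stars t n = odflt false (t a).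
Proof.
move=> an; rewrite /delete_stars (xget_unique _ an)// => y yn.
exact: is_nth_unique yn an.
Qed.

(** Up to the [m]-th kept position [p], both the kept positions and their
    values are those of any set agreeing with [A] up to [p]. *)
Lemma calG_local (J : set Npos -> set Npos) (A : set Npos) (m : nat) :
  J set0 = set0 -> infinite_set (kept (ternary J A)) ->
  exists M, forall B, agree M A B -> agree m (calG J A) (calG J B).
Proof.
move=> J0 Kinf; have [p pm] := infinite_nth (succN m) Kinf.
exists p.+1 => B AB n nm.
have [|z zp zn] := @is_nth_prefix (kept (ternary J A)) n m.+1 p _ pm.
  by rewrite Npos_gt0 ltnW // ltnW.
have tAB : agree z.+1 (ternary J A) (ternary J B).
  by apply: ternary_agree => //; exact: agreeW AB.
rewrite /calG (delete_starsE zn) (delete_starsE (a := z)) ?tAB //.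
exact: is_nth_agree (kept_agree tAB) zn.
Qed.

(** * Injectivity of the decoding map on the family *)

(** Membership in [calA J] forbids an element to be starred by any initial
    segment below it; here only the segment of all preceding elements is
    tested, which is what decides the star in the ternary sequence. *)
Definition star_free (J : set Npos -> set Npos) (A : set Npos) : Prop :=
  forall x, A x -> ~ J (below A x) x.

Lemma calA_star_free (J : set Npos -> set Npos) (A : set Npos) :
  J set0 = set0 -> calA J A -> star_free J A.
Proof.
move=> J0 cA x Ax Jx; have [r0 Jp] := Jplus_below J0 Jx.
suff : (A `&` Jplus J A) x by rewrite cA.
by split=> //; exists (rank A x).
Qed.

(** At the first position where two star-free sets differ, neither ternary
    sequence has a star, and it is kept with the same number but opposite
    values. *)
Lemma calG_step (J : set Npos -> set Npos) (A B : set Npos) (x : Npos) :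
  J set0 = set0 -> star_free J A -> calG J A = calG J B -> agree x A B ->
  A x -> B x.
Proof.
move=> J0 fA GAB AB Ax; apply: contrapT => nBx.
have tA : ternary J A x = Some true by rewrite ternaryE // (asboolT Ax).
have tB : ternary J B x = Some false.
  rewrite ternaryE // (asboolF nBx) -(agree_below AB) asboolF //.
  exact: fA.
have nA : is_nth (kept (ternary J A)) (succN (rank (kept (ternary J A)) x)) x.
  by apply/is_nthP; split=> //; rewrite /kept /= tA.
have nB : is_nth (kept (ternary J B)) (succN (rank (kept (ternary J A)) x)) x.
  apply/is_nthP; split; first by rewrite /kept /= tB.
  by congr _.+1; apply: rank_agree; apply: kept_agree; exact: ternary_agree.
have := congr1 (fun s => s (succN (rank (kept (ternary J A)) x))) GAB.
by rewrite /calG (delete_starsE nA) (delete_starsE nB) tA tB.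
Qed.

Lemma calG_inj (J : set Npos -> set Npos) (A B : set Npos) :
  J set0 = set0 -> star_free J A -> star_free J B ->
  calG J A = calG J B -> A = B.
Proof.
move=> J0 fA fB GAB; apply/funext; apply: Npos_ltn_ind => x IHx.
apply/propext; split; first exact: (calG_step J0 fA GAB IHx).
exact: (calG_step J0 fB (esym GAB) (agree_sym IHx)).
Qed.

(** * The greedy construction *)

Section Greedy.
Context (J : set Npos -> set Npos).
Hypothesis J0 : J set0 = set0.
Hypothesis calA_subset :
  forall A B : set Npos, calA J A -> B `<=` A -> calA J B.
Hypothesis candidates_nonempty : forall (s : Npos -> bool) (n : nat),
  candidates J (greedy J s n) !=set0.
Hypothesis calF_calA : forall s : Npos -> bool, calA J (calF J s).

Implicit Types s t : Npos -> bool.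

Definition accepted s n : set Npos := (greedy J s n).1.
Definition considered s n : set Npos := (greedy J s n).1 `|` (greedy J s n).2.

(** The integer a_(n+1): [greedy J s n] is the state reached after [n] steps. *)
Definition next s n : Npos := least (candidates J (greedy J s n)).

Lemma greedy_agree s t n : agree n.+1 s t -> greedy J s n = greedy J t n.
Proof.
elim: n => //= n IHn st; rewrite IHn; last exact: agreeW st.
by rewrite st.
Qed.

Lemma acceptedS s n :
  accepted s n.+1 = if s (succN n) then next s n |` accepted s n
                    else accepted s n.
Proof. by rewrite /accepted /next /=; case: (s _). Qed.

Lemma considered0 s : considered s 0 = set0.
Proof. exact: setU0. Qed.

Lemma consideredS s n : considered s n.+1 = next s n |` considered s n.
Proof.
rewrite /considered /next /=; case: (s _) => /=; first by rewrite setUA.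
by rewrite setUCA.
Qed.

Lemma accepted_considered s n : accepted s n `<=` considered s n.
Proof. by move=> x; left. Qed.

Lemma next_candidate s n :
  ~ considered s n (next s n) /\ ~ J (accepted s n) (next s n).
Proof.
have [h _] := leastP (candidates_nonempty s n).
by split=> H; apply: h; [case: H => H; [left; left|right]|left; right].
Qed.

Lemma before_next s n (x : Npos) :
  (x < next s n)%N -> considered s n x \/ J (accepted s n) x.
Proof.
move=> xn; have [_ h] := leastP (candidates_nonempty s n).
have [/h|/contrapT[[]|]] := pselect (candidates J (greedy J s n) x).
- by rewrite leqNgt xn.
- by left; left.
- by right.
- by left; right.
Qed.

Lemma accepted_le s m n : (m <= n)%N -> accepted s m `<=` accepted s n.
Proof.
elim: n => [|n IHn]; first by rewrite leqn0 => /eqP ->.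
rewrite leq_eqVlt => /predU1P[->//|/IHn h x /h]; rewrite acceptedS.
by case: (s _) => //; right.
Qed.

Lemma accepted_calF s n : accepted s n `<=` calF J s.
Proof.
move=> x xn; exists n.+1 => //; exact: (@accepted_le s n n.+1).
Qed.

(** Every run of [n] steps can be continued by accepting, and what it then
    accepts lies in some [calF J t]; closure under subsets does the rest. *)
Lemma accept_next_calA s n : calA J (next s n |` accepted s n).
Proof.
pose t (x : Npos) := if x == n.+1 :> nat then true else s x.
have st : agree n.+1 s t by move=> x xn; rewrite /t ltn_eqF.
apply: calA_subset (calF_calA t) _.
apply: subset_trans (@accepted_calF t n.+1).
by rewrite acceptedS /t /= eqxx /accepted /next (greedy_agree st).
Qed.

(** The second clause tests [x] against the elements accepted before it, not
    against all of [accepted s n]: unlike membership in [J (accepted s n)], this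
    condition persists when larger integers are accepted. *)
Definition frontier s n : Prop :=
  (forall x, considered s n x -> (x < next s n)%N) /\
  (forall x : Npos, (x < next s n)%N -> ~ considered s n x ->
     J (below (accepted s n) x) x).

(** The construction never goes back: an integer skipped because it was
    starred stays excluded even if it leaves [J (accepted s n)] later on
    ([J] is not monotone).  Otherwise accepting it would give a set that is
    not star-free, against [accept_next_calA]. *)
Lemma frontierP s n : frontier s n.
Proof.
elim: n => [|n [lo hi]].
  split=> [x|x xn _]; first by rewrite considered0.
  by have := before_next xn; rewrite considered0 /accepted /= J0 => -[].
have Slow (x : Npos) : (x < next s n)%N -> accepted s n.+1 x = accepted s n x.
  move=> xn; rewrite acceptedS; case: (s _) => //; apply/propext; split.
    by case=> // xe; rewrite xe ltnn in xn.
  by right.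
have up : (next s n < next s n.+1)%N.
  have [nc _] := next_candidate s n.+1.
  rewrite consideredS in nc; rewrite ltnNge; apply/negP => le.
  have lt : (next s n.+1 < next s n)%N.
    rewrite ltn_neqAle le andbT; apply/negP => /eqP e.
    by apply: nc; left; exact: Npos_inj.
  have ncn : ~ considered s n (next s n.+1) by move=> h; apply: nc; right.
  have Jb := hi _ lt ncn.
  have free := calA_star_free J0 (accept_next_calA s n.+1).
  apply: (free (next s n.+1)); first by left.
  suff -> : below (next s n.+1 |` accepted s n.+1) (next s n.+1) =
            below (accepted s n) (next s n.+1) by [].
  apply: agree_below => x xn; rewrite -Slow; last exact: ltn_trans lt.
  apply/propext; split; last by right.
  by case=> // xe; rewrite xe ltnn in xn.
split=> [x|x xn].
  by rewrite consideredS => -[->//|/lo h]; exact: ltn_trans up.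
rewrite consideredS => nc.
have ncn : ~ considered s n x by move=> h; apply: nc; right.
have [xlt|] := ltnP x (next s n).
  rewrite (@agree_below x _ (accepted s n)); first exact: hi.
  by move=> y yx; apply: Slow; exact: ltn_trans xlt.
rewrite leq_eqVlt => /predU1P[e|nx].
  by exfalso; apply: nc; left; exact/esym/Npos_inj.
have [|] := before_next xn; first by rewrite consideredS.
suff -> : below (accepted s n.+1) x = accepted s n.+1 by [].
apply/seteqP; split=> y; first by case.
move=> ya; split=> //=; move: (accepted_considered ya).
by rewrite consideredS => -[->//|/lo h]; exact: ltn_trans nx.
Qed.

Lemma considered_ltn s n x : considered s n x -> (x < next s n)%N.
Proof. by have [h _] := frontierP s n; exact: h. Qed.

Lemma skipped_starred s n (x : Npos) : (x < next s n)%N ->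
  ~ considered s n x -> J (below (accepted s n) x) x.
Proof. by have [_ h] := frontierP s n; exact: h. Qed.

Lemma next_ltnS s n : (next s n < next s n.+1)%N.
Proof. by apply: considered_ltn; rewrite consideredS; left. Qed.

Lemma next_le s m n : (m <= n)%N -> (next s m <= next s n)%N.
Proof.
elim: n => [|n IHn]; first by rewrite leqn0 => /eqP ->.
rewrite leq_eqVlt => /predU1P[->//|/IHn h].
exact: leq_trans h (ltnW (next_ltnS s n)).
Qed.

Lemma ltn_next s n : (n < next s n)%N.
Proof.
elim: n => [|n IHn]; first exact: Npos_gt0.
exact: leq_ltn_trans IHn (next_ltnS s n).
Qed.

(** Integers accepted after step [n] are at least [next s n], so
    [accepted s n] is the part of [calF J s] below [next s n]. *)
Lemma accepted_later s m n (x : Npos) :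
  accepted s m x -> (x < next s n)%N -> accepted s n x.
Proof.
move=> + xn; elim: m => [[]|m IHm]; rewrite acceptedS.
case E: (s _) => // -[xe|/IHm //].
have mn : (m < n)%N.
  by rewrite ltnNge; apply/negP => /(next_le s); rewrite leqNgt -xe xn.
by apply: (accepted_le mn); rewrite acceptedS E; left.
Qed.

Lemma calF_below s n (x : Npos) :
  (x < next s n)%N -> calF J s x = accepted s n x.
Proof.
move=> xn; apply/propext; split; last exact: accepted_calF.
by move=> [m _ xm]; exact: accepted_later xm xn.
Qed.

Lemma consideredE s n :
  considered s n = [set x | exists2 k, (k < n)%N & x = next s k].
Proof.
elim: n => [|n IHn].
  by rewrite considered0; apply/seteqP; split=> // x [].
rewrite consideredS IHn; apply/seteqP; split=> x /=.
  by move=> [->|[k kn ->]]; [exists n|exists k => //; exact: leqW].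
move=> [k]; rewrite ltnS leq_eqVlt => /predU1P[-> ->|kn ->]; first by left.
by right; exists k.
Qed.

Lemma ternary_next s n :
  ternary J (calF J s) (next s n) = Some (s (succN n)).
Proof.
rewrite ternaryE //.
have -> : calF J s (next s n) = s (succN n) :> Prop.
  rewrite (calF_below (n := n.+1)) ?next_ltnS // acceptedS.
  have [nc _] := next_candidate s n.
  case: (s _); apply/propext; split=> //; first by left.
  by move=> /accepted_considered.
rewrite asboolb; case: (s _) => //.
have -> : below (calF J s) (next s n) = accepted s n.
  rewrite (@agree_below _ _ (accepted s n)); last exact: calF_below.
  apply/seteqP; split=> x; first by case.
  by move=> xa; split=> //=; exact/considered_ltn/accepted_considered.
by rewrite asboolF //; have [] := next_candidate s n.
Qed.

(** An integer never examined was skipped, hence starred by the smaller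
    elements of [calF J s]. *)
Lemma kept_calF s : kept (ternary J (calF J s)) = range (next s).
Proof.
apply/seteqP; split=> x; last by move=> [n _ <-]; rewrite /kept /= ternary_next.
rewrite /kept /= => xk; have xx := ltn_next s x.
have [|nc] := pselect (considered s x x).
  by rewrite consideredE => -[k _ ->]; exists k.
exfalso; apply: xk; rewrite ternaryE // asboolF.
  rewrite (@agree_below _ _ (accepted s x)); first exact/ifT/asboolT/skipped_starred.
  by move=> y yx; apply: calF_below; exact: ltn_trans xx.
by rewrite (calF_below xx) => /accepted_considered.
Qed.

Lemma next_nth s n : is_nth (range (next s)) n.+1 (next s n).
Proof.
elim: n => [|n IHn].
  by left; split=> [|_ [k _ <-]]; [exists 0|exact: next_le].
apply: is_nth_next IHn _; split=> [|_ [[k _ <-] /= nk]].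
  by split; [exists n.+1|exact: next_ltnS].
by apply: next_le; rewrite ltnNge; apply/negP => /(next_le s); rewrite leqNgt nk.
Qed.

Lemma calFK s : calG J (calF J s) = s.
Proof.
apply/funext => n; rewrite -(succN_pred n) /calG.
rewrite (delete_starsE (a := next s n.-1)) ?ternary_next //.
by rewrite kept_calF; exact: next_nth.
Qed.

(** After [m] steps everything up to [m] is settled, because [next s m]
    exceeds [m]. *)
Lemma calF_agree s t m : agree m.+1 s t -> agree m.+1 (calF J s) (calF J t).
Proof.
move=> st x xm; have xn u : (x < next u m)%N.
  by apply: leq_ltn_trans (ltn_next u m); rewrite -ltnS.
by rewrite !(calF_below (xn _)) /accepted (greedy_agree st).
Qed.

End Greedy.

(** * Continuity as local dependence on initial segments *)

Section Topology.
Context (R : realType).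
Local Open Scope ring_scope.

Lemma agree_upto (A B : set Npos) (k : nat) (a : Npos) :
  (a < k)%N -> agree k A B -> A `&` upto a = B `&` upto a.
Proof.
move=> ak h; apply/seteqP; split=> x [Xx xa]; split=> //.
  by rewrite -h //; exact: leq_ltn_trans xa ak.
by rewrite h //; exact: leq_ltn_trans xa ak.
Qed.

(** Sets first differing at [a] are at distance [2 ^ (1 - a)], so the radius
    [2 ^ (1 - k)] forces the first difference beyond [k]. *)
Lemma rho_agree (k : nat) (A B : set Npos) :
  rho R A B < 2 ^ (- k%:Z + 1) -> agree k A B.
Proof.
rewrite /rho; case: asboolP => [->//|AB].
rewrite ltr_eXz2l ?ltr1n// => lt.
move=> x xk; have [_ /(_ x) h] := leastP (differ AB).
have e : A `&` upto x = B `&` upto x.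
  apply: contrapT => /h; set n := (least _ : nat) in lt *; lia.
have xx : upto x x by exact: leqnn.
apply/propext; split=> Xx.
  by have : (A `&` upto x) x; [split|rewrite e => -[]].
by have : (B `&` upto x) x; [split|rewrite -e => -[]].
Qed.

Lemma rho_lt (e : R) : 0 < e ->
  exists k : nat, forall A B : set Npos, agree k A B -> rho R A B < e.
Proof.
move=> e0; have [k ke] : exists k : nat, (2 : R) ^ (- k%:Z + 1) < e.
  exists (Num.bound e^-1).+1; rewrite intS opprD addrAC addNr add0r -exprnN.
  rewrite invf_plt ?posrE ?exprn_gt0 //.
  exact: Num.Theory.upper_nthrootP.
exists k => A B AB; apply: le_lt_trans ke; rewrite /rho.
case: asboolP => [_|ne]; first by rewrite exprz_ge0.
have [dA _] := leastP (differ ne); rewrite ler_weXz2l ?ler1n//.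
have : ~ (least [set a : Npos | A `&` upto a <> B `&` upto a] < k)%N.
  by move=> lt; apply: dA; exact: agree_upto lt AB.
lia.
Qed.

Lemma supp_agree (k : nat) (s t : Npos -> bool) :
  agree k (supp s) (supp t) <-> agree k s t.
Proof.
split=> h x /h; rewrite /supp /=; last by move=> ->.
by move=> e; apply/idP/idP; rewrite e.
Qed.

Lemma nbhs_powN (A : powN R) (U : set (powN R)) :
  nbhs A U <-> exists k : nat, forall B : set Npos, agree k A B -> U B.
Proof.
split=> [/nbhs_ballP[e /= e0 eU]|[k kU]].
  have [k ke] := rho_lt e0; exists k => B /ke AB.
  by apply: eU; rewrite ballEmdist.
apply/nbhs_ballP; exists (2 ^ (- k%:Z + 1)); first by rewrite /= exprz_gt0.
by move=> B; rewrite ballEmdist => AB; apply: kU; exact: rho_agree AB.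
Qed.

Lemma nbhs_binseq (s : binseq R) (U : set (binseq R)) :
  nbhs s U <-> exists k : nat, forall t : Npos -> bool, agree k s t -> U t.
Proof.
split=> [/nbhs_ballP[e /= e0 eU]|[k kU]].
  have [k ke] := rho_lt e0; exists k => t /supp_agree/ke st.
  by apply: eU; rewrite ballEmdist.
apply/nbhs_ballP; exists (2 ^ (- k%:Z + 1)); first by rewrite /= exprz_gt0.
by move=> t; rewrite ballEmdist => st; apply/kU/supp_agree; exact: rho_agree st.
Qed.

End Topology.

Theorem theorem4p1 (R : realType) (J : set Npos -> set Npos)
  (J0 : J set0 = set0)
  (calA_subset : forall A B : set Npos, calA J A -> B `<=` A -> calA J B)
  (a_exists : forall (s : Npos -> bool) (n : nat),
     candidates J (greedy J s n) !=set0)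
  (F_in_calA : forall s : Npos -> bool, calF J s \in calA J)
  (G_infinite : forall A : set Npos, infinite_set (kept (ternary J A))) :
  let F : binseq R -> subA R J := fun s => SigSub (F_in_calA s) in
  let G : powN R -> binseq R := calG J in
  let GA : subA R J -> binseq R := fun A => G (set_val A) in
  [/\ continuous F /\ bijective F,
      continuous G /\ set_surj setT setT G,
      continuous GA /\ bijective GA
    & homeomorphism F].
Proof.
move=> F G GA.
have F_calA s : calA J (calF J s) by apply/set_mem.
have FK : cancel F GA by move=> s; exact: calFK.
have GAK : cancel GA F.
  move=> A; apply: val_inj; apply: (@calG_inj J) => //.
  - exact: calA_star_free (F_calA _).
  - by apply: calA_star_free => //; exact/set_mem/valP.
  - by rewrite /= calFK.
have contG : continuous G.
  move=> A U /nbhs_binseq[m mU]; apply/nbhs_powN.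
  have [M ML] := @calG_local J A m J0 (G_infinite A).
  by exists M => B /ML h; exact: mU.
have contF : continuous F.
  apply: continuous_comp_initial => s U /nbhs_powN[m mU]; apply/nbhs_binseq.
  exists m.+1 => t st; apply: mU; apply: agreeW (leqnSn m) _.
  exact: calF_agree.
have contGA : continuous GA.
  by move=> A; apply: continuous_comp; [exact: initial_continuous|exact: contG].
have bijF : bijective F by exists GA.
have bijGA : bijective GA by exists F.
split=> //; last by split=> //; exists GA.
split=> // s _; exists (calF J s) => //; exact: calFK.
Qed.
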